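(* Let $n\geq 1$ and $0=x_{n,0}<x_{n,1}<\dots<x_{n,n-1}<x_{n,n}=1$. Let $\gamma_{n-1,0}>0$, define $$\gamma_{n-1,k}:=\gamma_{n-1,0}\prod_{l=1}^{k}\frac{1-x_{n,l}}{x_{n,l}}\qquad (k=1,\dots,n),$$ put $\gamma_{n-1,-1}:=0$, and define $$Q_{n-1}(x)=\sum_{k=0}^{n-1}\gamma_{n-1,k}\,x^k(1-x)^{n-1-k}.$$ Then $Q_{n-1}$ satisfies property (W), and the operator $$R_nf(x)=\sum_{k=0}^{n}f(x_{n,k})\,(\gamma_{n-1,k}+\gamma_{n-1,k-1})\,\frac{x^k(1-x)^{n-k}}{Q_{n-1}(x)},\qquad f\in C[0,1],$$ is the rational Bernstein operator associated with $Q_{n-1}$ fixing $e_0$ and $e_1$ (so $R_ne_0=e_0$ and $R_ne_1=e_1$, where $e_0(x)=1$ and $e_1(x)=x$).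
   Context: $C[0,1]$ is the space of continuous real-valued functions on $[0,1]$. Property (W) for a polynomial $Q_{n-1}(x)=\sum_{k=0}^{n-1}w_{n-1,k}\binom{n-1}{k}x^k(1-x)^{n-1-k}$ with strictly positive Bernstein coefficients $w_{n-1,k}$ means: $\frac{w_{n-1,k-1}w_{n-1,k+1}}{w_{n-1,k}^2}<\frac{k+1}{k}\cdot\frac{n-k}{n-k-1}$ for $k=1,\dots,n-2$. For a polynomial $Q_{n-1}$ of degree at most $n-1$ with strictly positive Bernstein coefficients and property (W), the rational Bernstein operator associated with $Q_{n-1}$ fixing $e_0,e_1$ is the unique operator of the form $f\mapsto \sum_{k=0}^{n}f(y_k)\,\overline{w}_k\binom{n}{k}\frac{x^k(1-x)^{n-k}}{Q_{n-1}(x)}$ with positive weights $\overline{w}_k$ and nodes $0=y_0<y_1<\dots<y_n=1$ that maps $e_0$ to $e_0$ and $e_1$ to $e_1$. *)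

(* Defs.v *)
From mathcomp Require Import all_boot all_order all_algebra.
From mathcomp Require Import all_classical all_reals all_analysis.

Set Implicit Arguments.
Unset Strict Implicit.
Unset Printing Implicit Defensive.

Import Order.TTheory GRing.Theory Num.Theory.
Import numFieldNormedType.Exports.

Local Open Scope classical_set_scope.
Local Open Scope ring_scope.

(* Finite families indexed by 0, ..., n (nodes, weights, coefficients) are
   functions on nat of which only the values at the indices in range matter.
   Elements of C[0,1] are functions R -> R continuous on [0,1] for the subspace
   topology; only their values on [0,1] matter. *)

Definition C01 (R : realType) (f : R -> R) : Prop :=
  {within `[0, 1]%classic, continuous f}.

Definition e0 (R : realType) : R -> R := fun=> 1.
Definition e1 (R : realType) : R -> R := fun x => x.

(* 0 = y_0 < y_1 < ... < y_n = 1 *)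
Definition nodes (R : realType) (n : nat) (y : nat -> R) : Prop :=
  [/\ y 0%N = 0, y n = 1 & forall k, (k < n)%N -> y k < y k.+1].

(* The w_k (k <= m) are the coefficients of Q in the Bernstein basis of degree
   m; having such an expansion amounts to Q being of degree at most m, and the
   w_k are then uniquely determined by Q. *)
Definition bernstein_coefs (R : realType) (m : nat) (Q : {poly R})
    (w : nat -> R) : Prop :=
  Q = \sum_(k < m.+1)
        (w k * 'C(m, k)%:R) *: ('X^k * (1 - 'X) ^+ (m - k)).

(* Q = Q_{n-1} with n >= 1; the strict positivity of its Bernstein coefficients
   is part of the property. *)
Definition property_W (R : realType) (n : nat) (Q : {poly R}) : Prop :=
  exists w : nat -> R,
    [/\ bernstein_coefs n.-1 Q w,
        forall k, (k <= n.-1)%N -> 0 < w k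
      & forall k, (1 <= k <= n - 2)%N ->
          w k.-1 * w k.+1 / w k ^+ 2
            < (k%:R + 1) / k%:R * ((n%:R - k%:R) / (n%:R - k%:R - 1))].

(* L is an operator on C[0,1] of the form
   f |-> sum_k f(y_k) wbar_k binom(n,k) x^k (1-x)^(n-k) / Q(x). *)
Definition rational_Bernstein_form (R : realType) (n : nat) (Q : {poly R})
    (L : (R -> R) -> R -> R) : Prop :=
  (forall f, C01 f -> C01 (L f)) /\
  exists (wbar y : nat -> R),
    [/\ forall k, (k <= n)%N -> 0 < wbar k,
        nodes n y
      & forall f, C01 f -> forall x, 0 <= x <= 1 ->
          L f x = \sum_(k < n.+1) f (y k) * wbar k * 'C(n, k)%:R *
                    (x ^+ k * (1 - x) ^+ (n - k) / Q.[x])].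

Definition fixes (R : realType) (L : (R -> R) -> R -> R) (f : R -> R) : Prop :=
  forall x, 0 <= x <= 1 -> L f x = f x.

(* Operators are identified when they agree, as functions on [0,1], on all
   elements of C[0,1]. *)
Definition is_rational_Bernstein_operator (R : realType) (n : nat)
    (Q : {poly R}) (L : (R -> R) -> R -> R) : Prop :=
  [/\ rational_Bernstein_form n Q L,
      fixes L (@e0 R), fixes L (@e1 R)
    & forall L' : (R -> R) -> R -> R,
        rational_Bernstein_form n Q L' ->
        fixes L' (@e0 R) -> fixes L' (@e1 R) ->
        forall f, C01 f -> forall x, 0 <= x <= 1 -> L' f x = L f x].

(* gammaW x g0 k is gamma_{n-1,k} for the nodes x and gamma_{n-1,0} = g0. *)
Definition gammaW (R : realType) (x : nat -> R) (g0 : R) (k : nat) : R :=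
  g0 * \prod_(1 <= l < k.+1) ((1 - x l) / x l).

(* gamma_{n-1,k-1}, with gamma_{n-1,-1} = 0. *)
Definition gammaW_pred (R : realType) (x : nat -> R) (g0 : R) (k : nat) : R :=
  if k is k'.+1 then gammaW x g0 k' else 0.

Definition Qpoly (R : realType) (n : nat) (x : nat -> R) (g0 : R) : {poly R} :=
  \sum_(k < n) gammaW x g0 k *: ('X^k * (1 - 'X) ^+ (n.-1 - k)).

Definition Rop (R : realType) (n : nat) (x : nat -> R) (g0 : R)
    (f : R -> R) (t : R) : R :=
  \sum_(k < n.+1) f (x k) * (gammaW x g0 k + gammaW_pred x g0 k) *
    (t ^+ k * (1 - t) ^+ (n - k) / (Qpoly n x g0).[t]).

(* Main.v *)
Require Import Defs.
From mathcomp Require Import all_boot all_order all_algebra.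
From mathcomp Require Import all_classical all_reals all_analysis.
From mathcomp Require Import ring lra.
Import Order.TTheory GRing.Theory Num.Theory.
Import numFieldNormedType.Exports.
Local Open Scope ring_scope.

(** Everything rests on the recurrence
    gamma_k x_k = gamma_(k-1) (1 - x_k), equivalently
    (gamma_k + gamma_(k-1)) x_k = gamma_(k-1), together with gamma_n = 0
    (because x_n = 1) and gamma_k > 0 for k < n.

    Multiplying Q by 1 = (1 - t) + t raises its degree to n and produces the
    coefficients gamma_k + gamma_(k-1): this is the reproduction of e_0.
    Weighting these coefficients by x_k leaves gamma_(k-1), which are the
    coefficients of t Q(t): this is the reproduction of e_1.

    Property (W) is, once the binomial coefficients are cancelled, the strict
    log-concavity gamma_(k-1) gamma_(k+1) < gamma_k ^ 2; by the recurrence it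
    says that (1 - x) / x strictly decreases from one node to the next.

    Uniqueness is the linear independence of the t^k (1 - t)^(n-k) on [0,1]
    ([bernstein_free]): the reproduction of e_0 determines the coefficients of
    an operator of the given form, and the reproduction of e_1 the products of
    these coefficients with the nodes; as the coefficients are positive, the
    nodes are determined too. *)

(** * Sums of Bernstein type *)

Definition bernstein_sum {R : realType} (n : nat) (a : nat -> R) (t : R) : R :=
  \sum_(k < n.+1) a k * (t ^+ k * (1 - t) ^+ (n - k)).

Lemma horner_bernstein {R : realType} (n : nat) (a : nat -> R) (t : R) :
  (\sum_(k < n.+1) a k *: ('X^k * (1 - 'X) ^+ (n - k))).[t] =
  bernstein_sum n a t.
Proof. by rewrite horner_sum; apply: eq_bigr => k _; rewrite !hornerE. Qed.

Lemma continuous_bernstein_sum {R : realType} (n : nat) (a : nat -> R) :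
  continuous (bernstein_sum n a : R -> R).
Proof.
rewrite -(funext (horner_bernstein n a)).
exact: continuous_horner.
Qed.

Lemma bernstein_sum_gt0 {R : realType} (n : nat) (a : nat -> R) (t : R) :
  (forall k, (k <= n)%N -> 0 < a k) -> 0 <= t <= 1 -> 0 < bernstein_sum n a t.
Proof.
move=> a_gt0 /andP[t_ge0 t_le1].
have s_ge0 : 0 <= 1 - t by rewrite subr_ge0.
have term_ge0 (k : 'I_n.+1) : 0 <= a k * (t ^+ k * (1 - t) ^+ (n - k)).
  by rewrite mulr_ge0 ?mulr_ge0 ?exprn_ge0// ltW// a_gt0// -ltnS.
(* A nonnegative sum with one positive term: the first if t = 0, else the last. *)
have [->|t_neq0] := eqVneq t 0.
  rewrite /bernstein_sum big_ord_recl /= subn0 subr0 expr0 expr1n !mulr1.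
  rewrite ltr_pwDl ?a_gt0// sumr_ge0// => k _.
  by rewrite expr0n /= mul0r mulr0.
rewrite /bernstein_sum big_ord_recr /= subnn expr0 mulr1.
rewrite ltr_wpDl ?mulr_gt0 ?a_gt0 ?exprn_gt0 ?lt0r ?t_neq0// sumr_ge0// => k _.
exact: (term_ge0 (widen_ord (leqnSn n) k)).
Qed.

(** The substitution t = u / (1 + u), for u = 0, ..., n, turns a vanishing sum
    into a polynomial in u with coefficients a_k, of degree at most n and with
    n + 1 roots. *)
Lemma bernstein_free {R : realType} (n : nat) (a b : nat -> R) :
  (forall t, 0 <= t <= 1 -> bernstein_sum n a t = bernstein_sum n b t) ->
  forall k, (k <= n)%N -> a k = b k.
Proof.
move=> eq_ab k le_kn.
pose p := \poly_(i < n.+1) (a i - b i).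
suff p0 : p = 0.
  have : p`_k = 0 by rewrite p0 coef0.
  by rewrite coef_poly ltnS le_kn => /eqP; rewrite subr_eq0 => /eqP.
pose s := [seq i%:R : R | i <- iota 0 n.+1].
have s_uniq : uniq s.
  by rewrite map_inj_uniq ?iota_uniq// => i j /eqP; rewrite eqr_nat => /eqP.
apply: (roots_geq_poly_eq0 _ s_uniq); last first.
  by rewrite size_map size_iota size_poly.
apply/allP => _ /mapP[i _ ->]; set u : R := i%:R.
have u_ge0 : 0 <= u by rewrite ler0n.
have v_gt0 : 0 < 1 + u by rewrite ltr_pwDl.
have v_neq0 : 1 + u != 0 by rewrite gt_eqF.
have t01 : 0 <= u / (1 + u) <= 1.
  by rewrite divr_ge0 ?(ltW v_gt0)//= ler_pdivrMr// mul1r lerDr.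
have homog c : (1 + u) ^+ n * bernstein_sum n c (u / (1 + u)) =
    \sum_(j < n.+1) c j * u ^+ j.
  rewrite /bernstein_sum mulr_sumr; apply: eq_bigr => j _.
  have -> : 1 - u / (1 + u) = (1 + u)^-1 by field.
  have le_jn : (j <= n)%N by rewrite -ltnS.
  rewrite exprMn -mulrA -exprD subnKC//.
  rewrite exprVn mulrCA; congr (_ * _).
  by rewrite mulrCA mulfV ?mulr1// expf_neq0.
rewrite rootE horner_poly.
under eq_bigr => j _ do rewrite mulrBl.
by rewrite sumrB -!homog eq_ab// subrr.
Qed.

Lemma bernstein_sum_shift {R : realType} (m : nat) (g : nat -> R) (t : R) :
  bernstein_sum m.+1 (fun k => if k is j.+1 then g j else 0) t =
  t * bernstein_sum m g t.
Proof.
rewrite /bernstein_sum big_ord_recl /= mul0r add0r mulr_sumr.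
by apply: eq_bigr => k _; rewrite subSS exprS; ring.
Qed.

(** Degree elevation: multiplication by 1 = (1 - t) + t. *)
Lemma bernstein_sum_elevate {R : realType} (m : nat) (g : nat -> R) (t : R) :
  g m.+1 = 0 ->
  bernstein_sum m.+1 (fun k => g k + (if k is j.+1 then g j else 0)) t =
  bernstein_sum m g t.
Proof.
move=> gm1.
have low : bernstein_sum m.+1 g t = (1 - t) * bernstein_sum m g t.
  rewrite /bernstein_sum big_ord_recr /= gm1 mul0r addr0 mulr_sumr.
  apply: eq_bigr => k _; have le_km : (k <= m)%N by rewrite -ltnS.
  by rewrite subSn// exprS; ring.
rewrite -[RHS]mul1r -[X in X * _](subrK t) mulrDl -low -bernstein_sum_shift.
by rewrite -big_split /=; apply: eq_bigr => k _; rewrite mulrDl.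
Qed.

(** * The coefficients gamma *)

Lemma nodes_homo {R : realType} (n : nat) (y : nat -> R) : nodes n y ->
  forall i j, (i < j)%N -> (j <= n)%N -> y i < y j.
Proof.
move=> [_ _ y_incr] i; elim=> [//|j IH]; rewrite ltnS leq_eqVlt.
move=> /orP[/eqP->|lt_ij] lt_jn; first exact: y_incr.
exact: lt_trans (IH lt_ij (ltnW lt_jn)) (y_incr j lt_jn).
Qed.

Lemma nodes_gt0 {R : realType} (n : nat) (y : nat -> R) (k : nat) :
  nodes n y -> (0 < k <= n)%N -> 0 < y k.
Proof. by move=> hy /andP[? ?]; have [<- _ _] := hy; apply: (nodes_homo n). Qed.

Lemma nodes_lt1 {R : realType} (n : nat) (y : nat -> R) (k : nat) :
  nodes n y -> (k < n)%N -> y k < 1.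
Proof. by move=> hy ?; have [_ <- _] := hy; apply: (nodes_homo n). Qed.

Lemma gammaWS {R : realType} (x : nat -> R) (g0 : R) (k : nat) :
  gammaW x g0 k.+1 = gammaW x g0 k * ((1 - x k.+1) / x k.+1).
Proof. by rewrite /gammaW big_nat_recr ?mulrA. Qed.

Lemma gammaW_gt0 {R : realType} (m : nat) (x : nat -> R) (g0 : R) (k : nat) :
  nodes m.+1 x -> 0 < g0 -> (k <= m)%N -> 0 < gammaW x g0 k.
Proof.
move=> hx g0_gt0; elim: k => [_|k IH lt_km].
  by rewrite /gammaW big_geq ?mulr1.
rewrite gammaWS mulr_gt0 ?IH 1?ltnW// divr_gt0//.
  by rewrite subr_gt0 (nodes_lt1 _ _ _ hx).
by rewrite (nodes_gt0 _ _ _ hx)//= ltnW.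
Qed.

Lemma gammaW_last {R : realType} (m : nat) (x : nat -> R) (g0 : R) :
  nodes m.+1 x -> gammaW x g0 m.+1 = 0.
Proof. by case=> _ x_last _; rewrite gammaWS x_last subrr mul0r mulr0. Qed.

(** The recurrence solved for x_k: this is why the operator, evaluating at the
    nodes x_k, sends e_1 to t Q(t) / Q(t). *)
Lemma gammaW_node {R : realType} (m : nat) (x : nat -> R) (g0 : R) (k : nat) :
  nodes m.+1 x -> (k <= m.+1)%N ->
  x k * (gammaW x g0 k + gammaW_pred x g0 k) = gammaW_pred x g0 k.
Proof.
move=> hx; case: k => [_|k lt_km] /=; first by case: hx => -> _ _; rewrite mul0r.
have xk_neq0 : x k.+1 != 0 by rewrite gt_eqF// (nodes_gt0 _ _ _ hx).
by rewrite gammaWS; field.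
Qed.

Lemma gammaWD_gt0 {R : realType} (m : nat) (x : nat -> R) (g0 : R) (k : nat) :
  nodes m.+1 x -> 0 < g0 -> (k <= m.+1)%N ->
  0 < gammaW x g0 k + gammaW_pred x g0 k.
Proof.
move=> hx g0_gt0; case: k => [_|k] /=.
  by rewrite addr0 (gammaW_gt0 m).
rewrite ltnS => le_km; rewrite ltr_wpDl ?(gammaW_gt0 m)//.
move: le_km; rewrite leq_eqVlt => /orP[/eqP->|lt_km].
  by rewrite (gammaW_last m).
by rewrite ltW// (gammaW_gt0 m).
Qed.

(** Consecutive gamma have quotient (1 - x) / x, a strictly decreasing function
    of the node x. *)
Lemma gammaW_log_concave {R : realType} (m : nat) (x : nat -> R) (g0 : R)
    (k : nat) :
  nodes m.+1 x -> 0 < g0 -> (k.+2 <= m)%N ->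
  gammaW x g0 k * gammaW x g0 k.+2 < gammaW x g0 k.+1 ^+ 2.
Proof.
move=> hx g0_gt0 le_km.
have lt_km : (k < m)%N by apply: ltnW.
have g_gt0 : 0 < gammaW x g0 k * gammaW x g0 k.+1.
  by rewrite mulr_gt0// (gammaW_gt0 m)// ltnW.
have a_gt0 : 0 < x k.+1 by rewrite (nodes_gt0 _ _ _ hx)//= ltnW.
have b_gt0 : 0 < x k.+2 by rewrite (nodes_gt0 _ _ _ hx)//= ltnW.
have lt_ab : x k.+1 < x k.+2 by case: hx => _ _; apply; apply: ltnW.
have -> : gammaW x g0 k * gammaW x g0 k.+2 =
    gammaW x g0 k * gammaW x g0 k.+1 * ((1 - x k.+2) / x k.+2).
  by rewrite gammaWS mulrA.
have -> : gammaW x g0 k.+1 ^+ 2 =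
    gammaW x g0 k * gammaW x g0 k.+1 * ((1 - x k.+1) / x k.+1).
  by rewrite expr2 [in X in X * _]gammaWS mulrAC.
rewrite ltr_pM2l// ltr_pdivrMr// mulrAC ltr_pdivlMr//.
lra.
Qed.

(** * The polynomial Q *)

Lemma horner_Qpoly {R : realType} (m : nat) (x : nat -> R) (g0 t : R) :
  (Qpoly m.+1 x g0).[t] = bernstein_sum m (gammaW x g0) t.
Proof. exact: horner_bernstein. Qed.

Lemma Qpoly_gt0 {R : realType} (m : nat) (x : nat -> R) (g0 t : R) :
  nodes m.+1 x -> 0 < g0 -> 0 <= t <= 1 -> 0 < (Qpoly m.+1 x g0).[t].
Proof.
move=> hx g0_gt0 t01; rewrite horner_Qpoly bernstein_sum_gt0// => k.
exact: gammaW_gt0.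
Qed.

(** The Bernstein coefficients are gamma_k / binom(m, k), and the right-hand
    side of (W) is exactly the factor
    binom(m, k) ^ 2 / (binom(m, k-1) binom(m, k+1)) that the binomials bring in,
    so that (W) reduces to [gammaW_log_concave]. *)
Lemma Qpoly_property_W {R : realType} (m : nat) (x : nat -> R) (g0 : R) :
  nodes m.+1 x -> 0 < g0 -> property_W m.+1 (Qpoly m.+1 x g0).
Proof.
move=> hx g0_gt0; exists (fun k => gammaW x g0 k / 'C(m, k)%:R); split=> /=.
- rewrite /bernstein_coefs /Qpoly; apply: eq_bigr => k _.
  by rewrite mulfVK// pnatr_eq0 -lt0n bin_gt0 -ltnS.
- by move=> k le_km; rewrite divr_gt0 ?ltr0n ?bin_gt0// (gammaW_gt0 m).
case=> [//|k] /andP[_ le_k]; rewrite [k.+1.-1]/=.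
have le_km : (k.+2 <= m)%N by rewrite subSS ltn_subRL add1n in le_k.
have := gammaW_log_concave m x g0 k hx g0_gt0 le_km.
have g1_gt0 := gammaW_gt0 m x g0 k.+1 hx g0_gt0 (ltnW le_km).
move: (gammaW x g0 k) (gammaW x g0 k.+1) (gammaW x g0 k.+2) g1_gt0.
move=> ga gb gc gb_gt0 concave.
have bin_pos j : (j <= m)%N -> 0 < 'C(m, j)%:R :> R by rewrite ltr0n bin_gt0.
have le_k0m : (k <= m)%N by rewrite ltnW// ltnW.
have A_gt0 := bin_pos k le_k0m.
have B_gt0 := bin_pos k.+1 (ltnW le_km).
have C_gt0 := bin_pos k.+2 le_km.
have := mul_bin_left m k; have := mul_bin_left m k.+1.
move=> /(congr1 (fun i => i%:R : R)) + /(congr1 (fun i => i%:R : R)).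
rewrite !natrM !natrB ?(ltnW le_km)// => recC recB.
move: ('C(m, k)%:R : R) ('C(m, k.+1)%:R : R) ('C(m, k.+2)%:R : R)
  A_gt0 B_gt0 C_gt0 recB recC => A B C A_gt0 B_gt0 C_gt0 recB recC.
have k2_le_m : k%:R + 2 <= m%:R :> R by rewrite -natrD ler_nat addn2.
have k_ge0 : 0 <= k%:R :> R by [].
rewrite -!natr1 in recB recC *.
have -> : (k%:R + 1 + 1) / (k%:R + 1) *
    ((m%:R + 1 - (k%:R + 1)) / (m%:R + 1 - (k%:R + 1) - 1)) =
    B ^+ 2 / (A * C) :> R.
  have k1_neq0 : k%:R + 1 != 0 :> R by lra.
  have k2_neq0 : k%:R + 1 + 1 != 0 :> R by lra.
  have mk_neq0 : m%:R - k%:R != 0 :> R by lra.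
  have mk1_neq0 : m%:R - (k%:R + 1) != 0 :> R by lra.
  have -> : A = (k%:R + 1) * B / (m%:R - k%:R).
    by rewrite recB mulrAC divff ?mul1r.
  have -> : C = (m%:R - (k%:R + 1)) * B / (k%:R + 1 + 1).
    by rewrite -recC mulrAC divff ?mul1r.
  by field; rewrite gt_eqF//=; lra.
have -> : ga / A * (gc / C) / (gb / B) ^+ 2 =
    (ga * gc / gb ^+ 2) * (B ^+ 2 / (A * C)).
  by field; rewrite !gt_eqF.
rewrite gtr_pMl ?divr_gt0 ?mulr_gt0 ?exprn_gt0//.
by rewrite ltr_pdivrMr ?exprn_gt0// mul1r.
Qed.

(** * The operator *)

Lemma Rop_bernstein {R : realType} (n : nat) (x : nat -> R) (g0 : R)
    (f : R -> R) (t : R) :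
  Rop n x g0 f t =
  bernstein_sum n (fun k => f (x k) * (gammaW x g0 k + gammaW_pred x g0 k)) t /
  (Qpoly n x g0).[t].
Proof.
by rewrite /bernstein_sum mulr_suml; apply: eq_bigr => k _; rewrite mulrA.
Qed.

Lemma C01_Rop {R : realType} (m : nat) (x : nat -> R) (g0 : R) (f : R -> R) :
  nodes m.+1 x -> 0 < g0 -> C01 (Rop m.+1 x g0 f).
Proof.
move=> hx g0_gt0; apply: continuous_in_subspaceT => t.
rewrite inE /= in_itv /= => t01.
rewrite (funext (Rop_bernstein m.+1 x g0 f)).
apply: continuousM; first exact: continuous_bernstein_sum.
apply: continuousV; first by rewrite gt_eqF// Qpoly_gt0.
exact: continuous_horner.
Qed.

Lemma Rop_e0 {R : realType} (m : nat) (x : nat -> R) (g0 : R) :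
  nodes m.+1 x -> 0 < g0 -> fixes (Rop m.+1 x g0) (@e0 R).
Proof.
move=> hx g0_gt0 t t01; rewrite Rop_bernstein /e0.
have -> : bernstein_sum m.+1
    (fun k => 1 * (gammaW x g0 k + gammaW_pred x g0 k)) t =
    (Qpoly m.+1 x g0).[t].
  rewrite horner_Qpoly -(bernstein_sum_elevate m) ?(gammaW_last m)//.
  by apply: eq_bigr => k _; rewrite mul1r.
by rewrite divff// gt_eqF// Qpoly_gt0.
Qed.

Lemma Rop_e1 {R : realType} (m : nat) (x : nat -> R) (g0 : R) :
  nodes m.+1 x -> 0 < g0 -> fixes (Rop m.+1 x g0) (@e1 R).
Proof.
move=> hx g0_gt0 t t01; rewrite Rop_bernstein /e1.
have -> : bernstein_sum m.+1
    (fun k => x k * (gammaW x g0 k + gammaW_pred x g0 k)) t =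
    t * (Qpoly m.+1 x g0).[t].
  rewrite horner_Qpoly -bernstein_sum_shift.
  by apply: eq_bigr => k _; rewrite (gammaW_node m)// -ltnS.
by rewrite mulfK// gt_eqF// Qpoly_gt0.
Qed.

Lemma Rop_form {R : realType} (m : nat) (x : nat -> R) (g0 : R) :
  nodes m.+1 x -> 0 < g0 ->
  rational_Bernstein_form m.+1 (Qpoly m.+1 x g0) (Rop m.+1 x g0).
Proof.
move=> hx g0_gt0; split=> [f _|]; first exact: C01_Rop.
exists (fun k => (gammaW x g0 k + gammaW_pred x g0 k) / 'C(m.+1, k)%:R), x.
split=> // [k le_km|f _ t _].
  by rewrite divr_gt0 ?ltr0n ?bin_gt0// (gammaWD_gt0 m).
rewrite /Rop; apply: eq_bigr => k _; congr (_ * _); rewrite -[RHS]mulrA mulfVK//.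
by rewrite pnatr_eq0 -lt0n bin_gt0 -ltnS.
Qed.

Lemma C01_e0 {R : realType} : C01 (@e0 R).
Proof. by apply: continuous_subspaceT => t; apply: cvg_cst. Qed.

Lemma C01_e1 {R : realType} : C01 (@e1 R).
Proof. by apply: continuous_subspaceT => t; apply: cvg_id. Qed.

(** Fixing e_0 and e_1 says that Q(t) and t Q(t) have the coefficients c_k and
    y_k c_k; as these are unique and c_k > 0, so are the nodes y_k. *)
Lemma rational_Bernstein_unique {R : realType} (n : nat) (Q : {poly R})
    (L L' : (R -> R) -> R -> R) :
  (forall t, 0 <= t <= 1 -> 0 < Q.[t]) ->
  rational_Bernstein_form n Q L -> fixes L (@e0 R) -> fixes L (@e1 R) ->
  rational_Bernstein_form n Q L' -> fixes L' (@e0 R) -> fixes L' (@e1 R) ->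
  forall f, C01 f -> forall t, 0 <= t <= 1 -> L' f t = L f t.
Proof.
move=> Q_gt0.
move=> [_ [w [y [w_gt0 _ LE]]]] L0 L1 [_ [w' [y' [_ _ LE']]]] L0' L1'.
pose c k := w k * 'C(n, k)%:R; pose c' k := w' k * 'C(n, k)%:R.
have form (v z : nat -> R) (f : R -> R) t :
    \sum_(k < n.+1) f (z k) * v k * 'C(n, k)%:R *
      (t ^+ k * (1 - t) ^+ (n - k) / Q.[t]) =
    bernstein_sum n (fun k => f (z k) * (v k * 'C(n, k)%:R)) t / Q.[t].
  by rewrite /bernstein_sum mulr_suml; apply: eq_bigr => k _; rewrite !mulrA.
have coefs (f : R -> R) : C01 f -> fixes L f -> fixes L' f ->
    forall k, (k <= n)%N -> f (y' k) * c' k = f (y k) * c k.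
  move=> fC Lf Lf'; apply: bernstein_free => t t01.
  have Q_neq0 : Q.[t]^-1 != 0 by rewrite invr_eq0 gt_eqF// Q_gt0.
  by apply: (mulIf Q_neq0); rewrite -(form w' y') -(form w y) -LE// -LE'// Lf// Lf'.
have eqc k : (k <= n)%N -> c' k = c k.
  by move=> /(coefs _ C01_e0 L0 L0'); rewrite !mul1r.
have eqy k : (k <= n)%N -> y' k = y k.
  move=> le_kn; have := coefs _ C01_e1 L1 L1' k le_kn; rewrite eqc//.
  by apply: mulIf; rewrite gt_eqF// mulr_gt0 ?w_gt0// ltr0n bin_gt0.
move=> f fC t t01; rewrite LE'// LE// (form w' y') (form w y); congr (_ / _).
apply: eq_bigr => k _; have le_kn : (k <= n)%N by rewrite -ltnS.
by rewrite eqy// -/(c' k) eqc.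
Qed.

Theorem proposition2 (R : realType) (n : nat) (x : nat -> R) (g0 : R)
    (hn : (1 <= n)%N) (hx : nodes n x) (hg0 : 0 < g0) :
  [/\ property_W n (Qpoly n x g0),
      is_rational_Bernstein_operator n (Qpoly n x g0) (Rop n x g0),
      fixes (Rop n x g0) (@e0 R)
    & fixes (Rop n x g0) (@e1 R)].
Proof.
case: n hn hx => [//|m] _ hx.
have form := Rop_form m x g0 hx hg0.
have fix0 := Rop_e0 m x g0 hx hg0.
have fix1 := Rop_e1 m x g0 hx hg0.
split=> //; first exact: Qpoly_property_W.
split=> // L' form' fix0' fix1'.
apply: (rational_Bernstein_unique m.+1 (Qpoly m.+1 x g0)) => // t t01.
exact: Qpoly_gt0.
Qed.
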